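(* Let $q$ be an odd prime power and let $\gamma,\delta\in\mathbb{F}_{q^2}$ with $\gamma\neq 0$. Then the polynomial $$f(x)=(x^q-x+\delta)^{2}+\gamma x$$ is a permutation polynomial of $\mathbb{F}_{q^2}$ if and only if $\gamma\in\mathbb{F}_q^*$ and $\mathrm{Tr}_q^{q^2}(\delta)-\mathrm{Tr}_q^{q^2}(\gamma)/4\neq 0$.
   Context: A polynomial over a finite field $\mathbb{F}$ is a permutation polynomial of $\mathbb{F}$ if the map it induces on $\mathbb{F}$ is a bijection. For $x\in\mathbb{F}_{q^2}$, $\mathrm{Tr}_q^{q^2}(x)=x+x^q$. *)

(* Defs.v *)
From HB Require Import structures.
From mathcomp Require Import all_boot all_order all_algebra all_field.

Set Implicit Arguments.
Unset Strict Implicit.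
Unset Printing Implicit Defensive.

Import GRing.Theory.
Local Open Scope ring_scope.

Definition prime_power (q : nat) : Prop :=
  exists p k : nat, [/\ prime p, (0 < k)%N & q = (p ^ k)%N].

(* Intended for a finite field [F]; the [finType] structure is not needed, so
   this also applies directly to a [fieldExtType] over a [finFieldType]. *)
Definition permutation_polynomial (F : fieldType) (f : {poly F}) : Prop :=
  bijective (fun x : F => f.[x]).

Definition Trq (F : fieldType) (q : nat) (x : F) : F := x + x ^+ q.

(* [Fq_units L] is the set of nonzero elements of the copy of the base field
   [K] inside its extension [L]: [1%VS] is the [K]-line spanned by [1]. *)
Definition Fq_units (K : fieldType) (L : fieldExtType K) : pred L :=
  [pred x | (x \in 1%VS) && (x != 0)].

Arguments Fq_units {K} L.

(* Main.v *)
Require Import Defs.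
From HB Require Import structures.
From mathcomp Require Import all_boot all_order all_algebra all_field.
From mathcomp Require Import ring.

Import GRing.Theory.
Local Open Scope ring_scope.

(** Write [s] for the [q]-power Frobenius, [T] for the trace of [delta] and
    [c = gamma - 2 T].  If [f x = f y] with [d = x - y], then dividing by
    [s d - d] expresses [2 (s x - x + delta) - (s d - d)], an element of trace
    [2 T], as [- gamma d / (s d - d)]; comparing traces yields
    [s (c d) = c d].  Conversely each such [d] not fixed by [s] gives a
    collision, since every element of trace zero has the form [s x - x].
    Hence [f] is injective iff [s (c d) = c d] forces [s d = d], i.e. iff [c]
    is nonzero and fixed by [s]. *)

Section Involution.

Variables (F : fieldType) (s : {rmorphism F -> F}) (gamma delta : F).
Hypotheses (sK : involutive s) (two_neq0 : 2%:R != 0 :> F).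

Let c := gamma - 2%:R * (delta + s delta).
Let f x := (s x - x + delta) ^+ 2 + gamma * x.

Lemma conj_c : s c = s gamma - 2%:R * (delta + s delta).
Proof. by rewrite rmorphB rmorphM rmorph_nat rmorphD sK [s delta + _]addrC. Qed.

Lemma collision_fixed x y :
  f x = f y -> s (x - y) != x - y -> s (c * (x - y)) = c * (x - y).
Proof.
rewrite -subr_eq0 => fxy; set d := x - y; set e := s d - d => e_neq0.
(* The two squared terms in [f x] and [f y] have bases with difference [e] and sum [w], so [e * w]
   is their difference of squares. *)
set w := 2%:R * (s x - x + delta) - e.
have ew : e * w = - (gamma * d).
  apply/eqP; rewrite -subr_eq0 opprK; apply/eqP.
  rewrite -[RHS](subrr (f y)) -[in X in _ = X - _]fxy /f /w /e /d rmorphB; ring.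
clearbody d.
have trw : w + s w = 2%:R * (delta + s delta).
  rewrite /w /e rmorphB rmorphM rmorph_nat rmorphD !rmorphB !sK; ring.
have sew : s gamma * s d = e * s w.
  have se : s e = - e by rewrite /e rmorphB sK opprB.
  by have := congr1 s ew; rewrite rmorphN !rmorphM se mulNr => /oppr_inj.
apply/eqP; rewrite -subr_eq0 [s (c * d)]rmorphM conj_c; apply/eqP.
(* By [sew] and [ew] the first two terms add up to [e * (w + s w)], which [trw] cancels against the
   last. *)
transitivity (s gamma * s d - gamma * d - 2%:R * (delta + s delta) * e).
  by rewrite /c /e; ring.
rewrite sew -trw -ew; ring.
Qed.

Lemma fixed_collision d :
  s d != d -> s (c * d) = c * d -> exists x, f x = f (x - d).
Proof.
rewrite -subr_eq0; set e := s d - d => e_neq0 scd.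
have se : s e = - e by rewrite /e rmorphB sK opprB.
(* A collision at distance [d] forces this value for the sum of the two bases; they must then be
   [(w + e) / 2] and [(w - e) / 2]. *)
pose w := - (gamma * d) / e.
have trw : w + s w = 2%:R * (delta + s delta).
  apply: (mulIf e_neq0).
  rewrite /w fmorph_div rmorphN rmorphM se.
  transitivity (s gamma * s d - gamma * d).
    by field; rewrite oppr_eq0 e_neq0.
  have /eqP := scd; rewrite rmorphM conj_c -subr_eq0 => /eqP scd0.
  by apply/eqP; rewrite -subr_eq0; apply/eqP; rewrite -[RHS]scd0 /c /e; ring.
(* The value that [s x - x] must take; it is attained because [t] has trace zero. *)
pose t := (w + e) / 2%:R - delta.
have st : s t = - t.
  rewrite /t rmorphB fmorph_div rmorphD rmorph_nat se.
  have -> : s w = 2%:R * (delta + s delta) - w by rewrite -trw addrC addKr.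
  by field.
(* Since [s t = - t], this [x] gives [s x - x = t / 2 + t / 2]. *)
exists (- t / 2%:R); set x := - t / _.
have sx : s x - x = t by rewrite /x fmorph_div rmorphN rmorph_nat st; field.
have ew : e * w = - (gamma * d) by rewrite mulrC divfK.
rewrite /f.
have -> : s (x - d) - (x - d) + delta = (s x - x) + delta - e.
  by rewrite rmorphB /e; ring.
rewrite sx.
have -> : t + delta = (w + e) / 2%:R by rewrite subrK.
apply/eqP; rewrite -subr_eq0; apply/eqP.
transitivity (e * w + gamma * d); first by field.
by rewrite ew addNr.
Qed.

Lemma injective_iff_fixed :
  gamma != 0 -> (exists d, s d != d) ->
  injective f <-> s gamma = gamma /\ c != 0.
Proof.
move=> gamma_neq0 [d0 sd0]; split=> [f_inj | [s_gamma c_neq0] x y fxy].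
  have fixP d : s (c * d) = c * d -> s d = d.
    move=> scd; apply/eqP; apply: contraTT isT => sd.
    have [x /f_inj xd] := fixed_collision _ sd scd.
    have d0E : d = 0 by rewrite -[d](subKr x) -xd subrr.
    by rewrite d0E rmorph0 eqxx in sd.
  have c_neq0 : c != 0.
    apply: contra sd0 => /eqP c0.
    by apply/eqP/fixP; rewrite c0 mul0r rmorph0.
  (* The choice [d = c^-1] makes [c * d = 1] fixed, so [c] is fixed, and with it [gamma], as [c] and
     [gamma] differ by a multiple of a trace. *)
  split=> //; have := fixP c^-1; rewrite divff // rmorph1 => /(_ erefl).
  rewrite fmorphV => /invr_inj.
  by rewrite conj_c => /addIr.
have sc : s c = c by rewrite conj_c s_gamma.
have sxy : s (x - y) = x - y.
  apply/eqP; apply: contraT => sxy; have := collision_fixed _ _ fxy sxy.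
  by rewrite rmorphM sc => /(mulfI c_neq0)/eqP; rewrite (negPf sxy).
apply/eqP; rewrite -subr_eq0 -(mulrI_eq0 _ (mulfI gamma_neq0)).
(* As [x - y] is fixed, the squared terms agree and only [gamma * x = gamma * y] remains. *)
have E : s x - x = s y - y.
  apply/eqP; rewrite -subr_eq0 -(subrr (x - y)) -{1}sxy rmorphB.
  by apply/eqP; ring.
by move: fxy; rewrite /f E => /addrI; rewrite mulrBr => ->; rewrite subrr.
Qed.

End Involution.

Section QuadraticFiniteExtension.

Variables (K : finFieldType) (L : fieldExtType K) (q : nat).
Hypotheses (card_K : #|K| = q) (dim_L : \dim {: L} = 2%N).

Lemma finite_inj_bij (f : L -> L) : injective f -> bijective f.
Proof. exact: (@injF_bij (finvect_type L)). Qed.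

(** [L] has [q ^ 2] elements, so this is Fermat's little theorem; it makes the Frobenius an
    involution. *)
Lemma expf_cardK (x : L) : (x ^+ q) ^+ q = x.
Proof.
apply/eqP; rewrite -exprM mulnn -dim_L -card_K.
by rewrite -(Fermat's_little_theorem {:L}) memvf.
Qed.

Lemma mem_base_expf (x : L) : (x \in 1%VS) = (x ^+ q == x).
Proof. by rewrite (Fermat's_little_theorem 1%AS) dimv1 card_K. Qed.

Lemma ex_expf_neq : exists d : L, d ^+ q != d.
Proof.
have /subvPn[d _ d_notin] : ~~ ({: L} <= (1%VS : {vspace L}))%VS.
  by apply/negP => /dimvS; rewrite dim_L dimv1.
by exists d; rewrite -mem_base_expf.
Qed.

Hypothesis q_prime_power : prime_power q.

Lemma prime_power_pchar : exists2 p, p \in [pchar L] & p.-nat q.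
Proof.
have [p [k [p_prime _ qE]]] := q_prime_power; exists p.
  by rewrite pchar_lalg (@card_finPcharP _ p k) // card_K.
by rewrite qE pnatX pnat_id.
Qed.

Lemma pnat_pchar : [pchar L].-nat q.
Proof. by have [p pL] := prime_power_pchar; rewrite -(eq_pnat _ (pcharf_eq pL)). Qed.

Lemma odd_two_neq0 : odd q -> 2%:R != 0 :> L.
Proof.
have [p pL pq] := prime_power_pchar => q_odd; apply/negP => two0.
have : 2%N \in [pchar L] by rewrite inE.
rewrite (pcharf_eq pL) => /eqP p2; move: pq q_odd card_K.
(* In characteristic 2, [q] is a power of 2; being odd it would be 1, too small for a field. *)
rewrite -p2 => /p_natP[[|k] ->]; last by rewrite oddX.
by move=> _ K1; have := finNzRing_gt1 K; rewrite K1.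
Qed.

Definition frob (x : L) : L := x ^+ q.

Fact frob_is_additive : {morph frob : x y / x - y}.
Proof. by move=> x y; rewrite /frob exprDn_pchar ?exprNn_pchar ?pnat_pchar. Qed.

Fact frob_is_monoid : monoid_morphism frob.
Proof. by split=> [|x y]; rewrite /frob ?expr1n ?exprMn. Qed.

Definition frobR : {rmorphism L -> L} :=
  HB.pack frob (GRing.isZmodMorphism.Build L L frob frob_is_additive)
    (GRing.isMonoidMorphism.Build L L frob frob_is_monoid).

End QuadraticFiniteExtension.

Theorem theorem3p2 (q : nat) (q_prime_power : prime_power q) (q_odd : odd q)
    (K : finFieldType) (card_K : #|K| = q)
    (L : fieldExtType K) (dim_L : \dim {: L} = 2%N)
    (gamma delta : L) (gamma_neq0 : gamma != 0) :
  permutation_polynomial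
    (('X^q - 'X + delta%:P) ^+ 2 + gamma%:P * 'X) <->
  (gamma \in Fq_units L /\ Trq q delta - Trq q gamma / 4%:R != 0).
Proof.
have two_neq0 := odd_two_neq0 K L q card_K q_prime_power q_odd : 2%:R != 0 :> L.
pose s := @frobR K L q card_K q_prime_power.
have sE x : s x = x ^+ q by [].
have sK : involutive s by move=> x; rewrite !sE (expf_cardK K L q card_K).
have [|inj_fixed fixed_inj] :=
    injective_iff_fixed L s gamma delta sK two_neq0 gamma_neq0.
  exact: ex_expf_neq K L q card_K dim_L.
pose f x := (s x - x + delta) ^+ 2 + gamma * x.
have fE x : (('X^q - 'X + delta%:P) ^+ 2 + gamma%:P * 'X).[x] = f x.
  by rewrite !hornerE.
have four_neq0 : 4%:R != 0 :> L by rewrite (natrM _ 2 2) mulf_neq0.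
(* For fixed [gamma] the trace of [gamma] is [2 gamma], so the left-hand quantity is [- c / 2], with
   [c] as in the involution argument. *)
have condE : s gamma = gamma ->
    (Trq q delta - Trq q gamma / 4%:R != 0) =
    (gamma - 2%:R * (delta + s delta) != 0).
  move=> s_gamma; rewrite /Trq -!sE s_gamma; congr (~~ _).
  have -> : gamma - 2%:R * (delta + s delta) =
      - 2%:R * (delta + s delta - (gamma + gamma) / 4%:R) by field.
  by rewrite mulf_eq0 oppr_eq0 (negPf two_neq0).
rewrite inE (mem_base_expf K L q card_K) gamma_neq0 andbT -sE.
split=> [f_bij | [/eqP s_gamma]].
  have [|s_gamma c_neq0] := inj_fixed.
    by move=> x y fxy; apply: (bij_inj f_bij); rewrite !fE.
  by rewrite condE // s_gamma eqxx.
rewrite condE // => c_neq0; apply: finite_inj_bij => x y.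
by rewrite !fE; apply: fixed_inj.
Qed.
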